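(* There is a constant $C$ such that for every $n\ge 5$, $$\frac{7}{4}n-C\le pr(K_n,K_{2,3})\le 2n-1.$$
   Context: $K_{2,3}$ is the complete bipartite graph with parts of sizes 2 and 3. A subgraph of an edge-colored graph is properly colored if any two adjacent edges receive different colors. $pr(K_n,G)$ denotes the maximum number of colors in an (arbitrary) edge-coloring of the complete graph $K_n$ that contains no properly colored copy of $G$. *)

(* Defs.v *)
From mathcomp Require Import all_boot.

Set Implicit Arguments.
Unset Strict Implicit.
Unset Printing Implicit Defensive.

Record sgraph := SGraph {
  vertex :> finType;
  adj : rel vertex;
  adj_sym : symmetric adj;
  adj_irrefl : irreflexive adj
}.

Section CompleteBipartite.
Variables a b : nat.

Definition bip_adj : rel ('I_a + 'I_b) :=
  fun x y => match x, y with
             | inl _, inr _ | inr _, inl _ => true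
             | _, _ => false
             end.

Lemma bip_adj_sym : symmetric bip_adj.
Proof. by case=> x [] y. Qed.

Lemma bip_adj_irrefl : irreflexive bip_adj.
Proof. by case. Qed.

Definition complete_bipartite := SGraph bip_adj_sym bip_adj_irrefl.
End CompleteBipartite.

Definition edges (n : nat) : {set {set 'I_n}} :=
  [set e : {set 'I_n} | #|e| == 2].

(* An edge-coloring of K_n is a function c on subsets of 'I_n of which only the
   values on edges n matter. *)

(* Two distinct edges of the copy are adjacent iff they are the images of xy
   and xz for some common endpoint x and distinct neighbours y, z of x. *)
Definition pc_copy (n : nat) (K : eqType) (c : {set 'I_n} -> K)
    (G : sgraph) (f : G -> 'I_n) : bool :=
  injectiveb f &&
  [forall x : G, forall y : G, forall z : G,
    [&& adj x y, adj x z & y != z] ==>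
      (c [set f x; f y] != c [set f x; f z])].

Definition has_pc_copy (n : nat) (K : eqType) (c : {set 'I_n} -> K)
    (G : sgraph) : bool :=
  [exists f : {ffun G -> 'I_n}, pc_copy c f].

Definition num_colors (n : nat) (K : eqType) (c : {set 'I_n} -> K) : nat :=
  size (undup [seq c e | e in edges n]).

(* A palette of 'C(n, 2) = #|edges n| colors is enough: see pr_max below. *)
Definition pr (n : nat) (G : sgraph) : nat :=
  \max_(c : {ffun {set 'I_n} -> 'I_('C(n, 2))} | ~~ has_pc_copy c G)
    num_colors c.

Lemma card_edges n : #|edges n| = 'C(n, 2).
Proof. by rewrite card_draws card_ord. Qed.

Lemma pr_max (n : nat) (G : sgraph) (K : eqType) (c : {set 'I_n} -> K) :
  ~~ has_pc_copy c G -> num_colors c <= pr n G.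
Proof.
move=> cG; set s := undup [seq c e | e in edges n].
have les : size s <= 'C(n, 2).
  by rewrite -card_edges -(size_image c (mem (edges n))) size_undup.
rewrite /num_colors -/s.
case: (posnP (size s)) => [-> //|s0].
have N0 : 0 < 'C(n, 2) by apply: leq_trans les.
pose d (e : {set 'I_n}) : 'I_('C(n, 2)) := insubd (Ordinal N0) (index (c e) s).
have sin e : e \in edges n -> c e \in s.
  by move=> eE; rewrite mem_undup; apply: image_f.
have dE e : e \in edges n -> val (d e) = index (c e) s.
  move=> eE; rewrite /d insubdK // -topredE /=.
  by apply: leq_trans les; rewrite index_mem sin.
have dc e e' : e \in edges n -> e' \in edges n -> (d e == d e') = (c e == c e').
  move=> eE eE'; rewrite -val_eqE /= !dE //.
  apply/eqP/eqP => [|-> //].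
  by move/(congr1 (nth (c e) s)); rewrite !nth_index ?sin.
have dG : ~~ has_pc_copy (finfun d) G.
  apply: contra cG => /existsP [f /andP[fi /forallP h]].
  have fE u v : adj u v -> [set f u; f v] \in edges n.
    move=> uv; rewrite inE cards2 (inj_eq (injectiveP _ fi)).
    have /negPf -> // : u != v.
    by apply: contraTneq uv => ->; rewrite adj_irrefl.
  apply/existsP; exists f; rewrite /pc_copy fi /=.
  apply/forallP => x; apply/forallP => y; apply/forallP => z; apply/implyP.
  move=> xyz; have /forallP/(_ z)/implyP/(_ xyz) := forallP (h x) y.
  case/and3P: xyz => xy xz _; rewrite !ffunE dc //; exact: fE.
apply: leq_trans (_ : num_colors (finfun d) <= _); last first.
  by rewrite /pr; apply: (bigmax_sup (finfun d)).
rewrite /num_colors -(size_map (fun y => index y s)).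
have us : uniq s by apply: undup_uniq.
rewrite -(size_map val (undup _)).
apply: uniq_leq_size.
  rewrite map_inj_in_uniq // => u v us1 vs1 /(congr1 (nth u s)).
  by rewrite !nth_index.
move=> i /mapP[u]; rewrite mem_undup => /imageP[e eE ->] ->.
apply/mapP; exists (d e); last by rewrite dE.
rewrite mem_undup; apply/imageP; exists e => //.
by rewrite ffunE.
Qed.

Lemma pr_attained (n : nat) (G : sgraph) (c0 : {set 'I_n} -> nat) :
  ~~ has_pc_copy c0 G ->
  exists2 c : {set 'I_n} -> nat, ~~ has_pc_copy c G & num_colors c = pr n G.
Proof.
move=> c0G.
case: (pickP (fun c : {ffun {set 'I_n} -> 'I_('C(n, 2))} =>
                ~~ has_pc_copy c G)) => [d dG|none]; last first.
  exists c0 => //; apply/eqP; rewrite eqn_leq pr_max //.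
  by rewrite /pr big_pred0.
pose A := [pred c : {ffun {set 'I_n} -> 'I_('C(n, 2))} | ~~ has_pc_copy c G].
have A0 : 0 < #|A| by apply/card_gt0P; exists d.
have [c cG prE] := eq_bigmax_cond (fun c => num_colors (fun_of_fin c)) A0.
exists (fun e => val (c e)).
  apply: contra cG => /existsP [f h]; apply/existsP; exists f.
  case/andP: h => fi /forallP h; rewrite /pc_copy fi.
  apply/forallP => x; apply/forallP => y; apply/forallP => z.
  by have /forallP/(_ z) := forallP (h x) y.
have -> : pr n G = num_colors c by rewrite -prE.
rewrite /num_colors -[RHS](size_map val) -undup_map_inj; last exact: val_inj.
by rewrite /image_mem -map_comp.
Qed.

(* Main.v *)
Require Import Defs.
From mathcomp Require Import all_boot all_order all_algebra.
From mathcomp Require Import zify lra.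

(* Upper bound: in a vertex-minimal coloring of K_n with at least 2n colors and
   no properly colored K_{2,3}, every vertex v has at least three private colors,
   i.e. colors seen only on edges at v.  Let v send three distinct private colors
   to x, y, z, and put S = {v, x, y, z}.  If two of x, y, z had private edges
   leaving S, a properly colored K_{2,3} would appear; so two of them, and then a
   third vertex of S, have all their private edges inside S.  Call these three
   a, b, c and let d be the fourth vertex of S.  Every w outside S is then joined
   to a, b, c, d in a single color, so deleting a, b, c loses only the six colors
   inside S, contradicting minimality.

   Lower bound: cut the vertices into blocks of four, color each block with six
   colors of its own, and color an edge between two blocks by the larger block
   index.  In a properly colored K_{2,3}, a vertex of the top block has at most one
   neighbour outside that block, which forces all five vertices into one block. *)

Set Implicit Arguments.
Unset Strict Implicit.
Unset Printing Implicit Defensive.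

Ltac neq := solve [assumption | rewrite eq_sym; assumption].

(** * Upper bound: colorings without a properly colored K_{2,3} *)

Section UpperBound.
Variables (T K : finType) (col : T -> T -> K).
Hypothesis colC : forall x y, col x y = col y x.

Definition pc_K23 (u v x y z : T) : bool :=
  [&& uniq [:: u; v; x; y; z],
      uniq [:: col u x; col u y; col u z],
      uniq [:: col v x; col v y; col v z],
      col u x != col v x, col u y != col v y & col u z != col v z].

Hypothesis noK23 : forall u v x y z, ~~ pc_K23 u v x y z.

Definition colors (A : {set T}) : {set K} :=
  [set col p.1 p.2 | p in setX A A & p.1 != p.2].

Lemma colorsP (A : {set T}) k :
  reflect (exists x y, [/\ x \in A, y \in A, x != y & k = col x y])
          (k \in colors A).
Proof.
apply: (iffP imsetP) => [[[x y]]|[x [y [xA yA xy ->]]]].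
  by rewrite !inE /= => /andP[/andP[xA yA] xy] ->; exists x, y.
by exists (x, y); rewrite // !inE /= xA yA.
Qed.

(** The relation is directed: the color is private to [v], not necessarily to [x], and other edges
    at [v] may share it. *)
Definition private_edge (A : {set T}) (v x : T) : bool :=
  [&& v \in A, x \in A, v != x & col v x \notin colors (A :\ v)].

Definition confined (A : {set T}) (S : seq T) (x : T) : bool :=
  [forall w, private_edge A x w ==> (w \in S)].

(** * Private edges and private stars *)

Section VertexSet.
Variable A : {set T}.
Local Notation P := (private_edge A).

Lemma private_edge_neq v x y z : P v x -> y \in A -> z \in A -> y != z ->
  y != v -> z != v -> col v x != col y z.
Proof.
case/and4P=> _ _ _ /negP h yA zA yz yv zv; apply/eqP => e; apply: h.
by rewrite e; apply/colorsP; exists y, z; rewrite !inE yv zv yA zA.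
Qed.

(** Privacy at [x] depends only on the color, so equal colors would make [xw] a private edge leaving
    [S]. *)
Lemma confined_neq S x w y : confined A S x -> P x y ->
  w \in A -> x != w -> w \notin S -> col x y != col x w.
Proof.
move=> /forallP/(_ w)/implyP cx /and4P[xA _ _ pxy] wA xw wS; apply/eqP => e.
by move/negP: wS; apply; apply: cx; rewrite /private_edge xA wA xw -e pxy.
Qed.

(* Otherwise {v, w} and {x, y, z} span a properly colored K_{2,3}. *)
Lemma private_star_repeats v x y z w :
  uniq [:: v; x; y; z] -> P v x -> P v y -> P v z ->
  uniq [:: col v x; col v y; col v z] -> w \in A -> w \notin [:: v; x; y; z] ->
  ~~ uniq [:: col w x; col w y; col w z].
Proof.
move=> u4 vx vy vz uc wA wS; apply/negP => uw.
move: u4 wS; rewrite /= !inE !negb_or !andbT.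
case/and3P=> /and3P[v_x v_y v_z] /andP[xy xz] yz /and4P[wv wx wy wz].
move/negP: (noK23 v w x y z); apply.
have [_ xA _ _] := and4P vx; have [_ yA _ _] := and4P vy.
have [_ zA _ _] := and4P vz.
apply/and5P; split=> //.
- by rewrite /= !inE !negb_or v_x v_y v_z xy xz yz wx wy wz eq_sym wv.
- by rewrite (private_edge_neq vx) //; neq.
by rewrite (private_edge_neq vy) ?(private_edge_neq vz) //; neq.
Qed.

(* Otherwise {x, y} and {v, w, w'} span a properly colored K_{2,3}: by
   [private_star_repeats], w sees y and z in one color, and w' sees x and z
   in one color. *)
Lemma private_star_outside v x y z w w' :
  uniq [:: v; x; y; z] -> P v x -> P v y -> P v z ->
  uniq [:: col v x; col v y; col v z] ->
  P x w -> P y w' -> w \notin [:: v; x; y; z] -> w' \notin [:: v; x; y; z] ->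
  False.
Proof.
move=> u4 vx vy vz uc xw yw' wS w'S.
have [vA xA _ _] := and4P vx; have [_ yA _ _] := and4P vy.
have [_ zA _ _] := and4P vz.
have [_ wA _ _] := and4P xw; have [_ w'A _ _] := and4P yw'.
have := private_star_repeats u4 vx vy vz uc wA wS.
have := private_star_repeats u4 vx vy vz uc w'A w'S.
move: u4 wS w'S uc; rewrite /= !inE !negb_or !andbT.
case/and3P=> /and3P[v_x v_y v_z] /andP[xy xz] yz.
case/and4P=> wv wx wy wz /and4P[w'v w'x w'y w'z] /andP[/andP[vxy _] _].
have w'yx : col y w' != col x w'.
  by rewrite (private_edge_neq yw') //; neq.
have w'yz : col y w' != col z w'.
  by rewrite (private_edge_neq yw') //; neq.
have wxy : col x w != col y w.
  by rewrite (private_edge_neq xw) //; neq.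
have wxz : col x w != col z w.
  by rewrite (private_edge_neq xw) //; neq.
rewrite ![col w _]colC ![col w' _]colC.
rewrite [col x w' == col y _]eq_sym (negPf w'yx) w'yz (negPf wxy) (negPf wxz).
rewrite /= !andbT !negbK.
move=> /eqP e' /eqP e.
have ww' : w != w'.
  by apply/eqP => ww'; move: w'yz; rewrite -ww' e eqxx.
move/negP: (noK23 x y v w w'); apply; rewrite /pc_K23 /= !inE !negb_or.
rewrite ![col _ v]colC vxy wxy [col x w' == _]eq_sym w'yx ww'.
rewrite [x == v]eq_sym [y == v]eq_sym v_x v_y xy.
rewrite [x == w]eq_sym [y == w]eq_sym wx wy.
rewrite [x == w']eq_sym [y == w']eq_sym w'x w'y.
rewrite [v == w]eq_sym [v == w']eq_sym wv w'v.
rewrite !(private_edge_neq vx, private_edge_neq vy) //; try neq.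
rewrite e' (private_edge_neq xw) //; try neq.
by rewrite e eq_sym (private_edge_neq yw') //; neq.
Qed.

Lemma private_star_confined v x y z :
  uniq [:: v; x; y; z] -> P v x -> P v y -> P v z ->
  uniq [:: col v x; col v y; col v z] ->
  confined A [:: v; x; y; z] x || confined A [:: v; x; y; z] y.
Proof.
move=> u4 vx vy vz uc; apply: contraT; rewrite negb_or !negb_forall.
case/andP=> /existsP[w] + /existsP[w'].
rewrite !negb_imply => /andP[xw wS] /andP[yw' w'S].
by case: (private_star_outside u4 vx vy vz uc xw yw' wS w'S).
Qed.

Lemma eq_confined S S' x : S =i S' -> confined A S x = confined A S' x.
Proof. by move=> e; apply: eq_forallb => w; rewrite e. Qed.

(** The star is symmetric in its leaves, so [private_star_confined] applies to each pair of them: at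
    most one leaf fails to be confined. *)
Lemma private_star_two_confined v x y z :
  uniq [:: v; x; y; z] -> P v x -> P v y -> P v z ->
  uniq [:: col v x; col v y; col v z] ->
  let S := [:: v; x; y; z] in
  [|| confined A S x && confined A S y, confined A S x && confined A S z
    | confined A S y && confined A S z].
Proof.
move=> u4 vx vy vz uc; rewrite /=; set S := [:: v; x; y; z].
have h1 := private_star_confined u4 vx vy vz uc.
have p2 : perm_eq [:: v; x; z; y] S by rewrite /S !perm_cons (perm_catC [:: z]).
have p3 : perm_eq [:: v; y; z; x] S by rewrite /S perm_cons (perm_catC [:: y; z]).
have := @private_star_confined v x z y; have := @private_star_confined v y z x.
rewrite (perm_uniq p2) (perm_uniq p3) !(eq_confined _ (perm_mem p2)).
rewrite !(eq_confined _ (perm_mem p3)).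
move=> /(_ u4 vy vz vx) h3 /(_ u4 vx vz vy) h2.
have {}h2 : confined A S x || confined A S z.
  apply: h2; rewrite (perm_uniq (s2 := [:: col v x; col v y; col v z])) //.
  by rewrite perm_cons (perm_catC [:: _]).
have {}h3 : confined A S y || confined A S z.
  apply: h3; rewrite (perm_uniq (s2 := [:: col v x; col v y; col v z])) //.
  by rewrite (perm_catC [:: col v y; col v z]).
by move: h1 h2 h3; rewrite -/S; do 3!case: (confined A S _).
Qed.

(** A color lost by deleting [v] occurs only at [v]. One edge is chosen for each of three lost
    colors; distinct colors force distinct leaves. *)
Lemma private_star_exists v : v \in A -> 2 < #|colors A :\: colors (A :\ v)| ->
  exists x y z, [/\ uniq [:: v; x; y; z], P v x, P v y, P v z &
    uniq [:: col v x; col v y; col v z]].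
Proof.
move=> vA; set Q := _ :\: _ => Q3.
have Qe k : k \in Q -> exists2 x, P v x & k = col v x.
  rewrite inE => /andP[nk /colorsP[x [y [xA yA xy e]]]].
  case: (eqVneq x v) => xv.
    exists y; last by rewrite e xv.
    by rewrite /private_edge -xv xA yA xy -{1}e xv nk.
  case: (eqVneq y v) => yv.
    exists x; last by rewrite e yv colC.
    by rewrite /private_edge vA xA -{1}yv eq_sym xy colC -{1}yv -e nk.
  by case/negP: nk; apply/colorsP; exists x, y; rewrite !inE xv yv.
have [s] : exists s, [/\ uniq s, size s = 3 & {subset s <= Q}].
  exists (take 3 (enum Q)); split; first by rewrite take_uniq ?enum_uniq.
    by rewrite size_takel // -cardE.
  by move=> k /mem_take; rewrite mem_enum.
case: s => [|k1 [|k2 [|k3 [|? ?]]]] [] // us _ sQ.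
have [x vx e1] := Qe _ (sQ k1 (mem_head _ _)).
have [|y vy e2] := Qe k2; first by apply: sQ; rewrite !inE eqxx orbT.
have [|z vz e3] := Qe k3; first by apply: sQ; rewrite !inE eqxx !orbT.
exists x, y, z; rewrite -e1 -e2 -e3; split=> //.
have [[_ _ v_x _] [_ _ v_y _] [_ _ v_z _]] := And3 (and4P vx) (and4P vy) (and4P vz).
rewrite cons_uniq !inE !negb_or v_x v_y v_z.
by apply: (@map_uniq _ _ (col v) [:: x; y; z]); rewrite map_cons /= -e1 -e2 -e3.
Qed.

(** * Sets in which every vertex has three private colors *)

Hypothesis private3 : forall v, v \in A -> 2 < #|colors A :\: colors (A :\ v)|.

(** The private star at [a] has three leaves, all in [S] by confinement, so they are exactly the
    other three vertices of [S]. *)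
Lemma confined_star S a b c d : S =i [:: a; b; c; d] -> a \in A ->
  confined A S a ->
  [/\ P a b, P a c, P a d & uniq [:: col a b; col a c; col a d]].
Proof.
move=> eS aA /forallP ca.
have [x [y [z [u4 ax ay az uc]]]] := private_star_exists aA (private3 aA).
have u3 : uniq [:: x; y; z] by case/andP: u4.
have sub : {subset [:: x; y; z] <= [:: b; c; d]}.
  move=> w wx; have : P a w by move: wx; rewrite !inE => /or3P[] /eqP->.
  move=> aw; move/implyP: (ca w) => /(_ aw); rewrite eS in_cons.
  by case: eqP => // wa; case/and4P: aw; rewrite wa eqxx.
have p : perm_eq [:: b; c; d] [:: x; y; z].
  have [_ e] := uniq_min_size u3 sub (leqnn 3).
  by rewrite perm_sym uniq_perm // (leq_size_uniq u3 sub).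
have : all (P a) [:: b; c; d] by rewrite (perm_all _ p) /= ax ay az.
case/and4P=> -> -> -> _; split=> //.
by have := perm_uniq (perm_map (col a) p); rewrite [RHS]uc.
Qed.

(* Otherwise {a, d} and {b, c, w} span a properly colored K_{2,3}. *)
Lemma confined_twin S a b c d w : S =i [:: a; b; c; d] -> uniq [:: a; b; c; d] ->
  {subset S <= A} -> confined A S a -> confined A S b -> confined A S c ->
  w \in A -> w \notin S -> col a w = col d w.
Proof.
move=> eS u4 sA ca cb cc wA wS; apply/eqP; apply: contraT => awdw.
have [aA bA cA dA] : [/\ a \in A, b \in A, c \in A & d \in A].
  by split; apply: sA; rewrite eS !inE eqxx ?orbT.
have eSb : S =i [:: b; a; c; d].
  by move=> i; rewrite eS !inE orbCA.
have eSc : S =i [:: c; a; b; d].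
  by move=> i; rewrite eS !inE; do 4!case: eqP => //.
have [ab ac ad /= uca] := confined_star eS aA ca.
have [ba bc bd ucb] := confined_star eSb bA cb.
have [_ _ cd _] := confined_star eSc cA cc.
have := wS; rewrite eS; move: u4 uca; rewrite /= !inE !negb_or !andbT.
case/and3P=> /and3P[a_b a_c a_d] /andP[b_c b_d] c_d /andP[/andP[abac _] _].
case/and4P=> wa wb wc wd.
move/negP: (noK23 a d b c w); case; rewrite /pc_K23 /= !inE !negb_or.
rewrite awdw abac a_b a_c a_d b_c.
rewrite [d == b]eq_sym [d == c]eq_sym b_d c_d.
rewrite [a == w]eq_sym [b == w]eq_sym [c == w]eq_sym [d == w]eq_sym wa wb wc wd.
(* At [a], confinement separates [aw] from [ab] and [ac]; at [d], the colors of [db] and [dc] are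
   private to [b] and [c]. *)
rewrite (confined_neq ca ab) ?(confined_neq ca ac) //; try neq.
rewrite [col d b]colC [col d c]colC.
rewrite !(private_edge_neq bd) ?(private_edge_neq cd) //; try neq.
by rewrite (private_edge_neq ab) ?(private_edge_neq ac) //; neq.
Qed.

(** By [confined_twin], applied to [a], [b] and [c] in turn, an edge from [S] to an outside vertex
    [w] has the color of [dw], which survives the deletion. Only the six edges inside [S] can lose
    their colors. *)
Lemma three_confined_colors S a b c d :
  S =i [:: a; b; c; d] -> uniq [:: a; b; c; d] ->
  {subset S <= A} -> confined A S a -> confined A S b -> confined A S c ->
  #|colors A| <= #|colors (A :\: [set a; b; c])| + 6.
Proof.
move=> eS u4 sA ca cb cc.
have eSb : S =i [:: b; a; c; d].
  by move=> i; rewrite eS !inE orbCA.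
have eSc : S =i [:: c; a; b; d].
  by move=> i; rewrite eS !inE; do 4!case: eqP => //.
have twin x w : x \in [:: a; b; c; d] -> w \in A -> w \notin S -> col x w = col d w.
  move=> xS wA wS; move: xS; rewrite !inE => /or4P[]/eqP-> //.
  - exact: (confined_twin eS u4).
  - apply: (confined_twin eSb) => //; move: u4.
    rewrite /= !inE !negb_or [b == a]eq_sym; do 6!case: (_ != _) => //.
  - apply: (confined_twin eSc) => //; move: u4.
    rewrite /= !inE !negb_or [c == a]eq_sym [c == b]eq_sym.
    by do 6!case: (_ != _) => //.
pose s := [:: col a b; col a c; col a d; col b c; col b d; col c d].
have dA : d \in A by apply: sA; rewrite eS !inE eqxx !orbT.
have d3 : d \notin [:: a; b; c].
  move: u4; rewrite -[_ :: _]/([:: a; b; c] ++ [:: d]) cat_uniq /= orbF.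
  by case/and3P.
have out x w : x \in [:: a; b; c; d] -> w \in A -> w \notin S ->
    col x w \in colors (A :\: [set a; b; c]).
  move=> xS wA wS; rewrite (twin _ _ xS wA wS); apply/colorsP; exists d, w.
  move: wS d3; rewrite eS !inE !negb_or => /and4P[wa wb wc wd].
  case/and3P=> da db dc.
  by rewrite da db dc dA wa wb wc wA eq_sym wd.
have sub : colors A \subset colors (A :\: [set a; b; c]) :|: [set k in s].
  apply/subsetP => k /colorsP[x [y [xA yA xy ->]]]; rewrite in_setU.
  case: (boolP (x \in S)) => xS; case: (boolP (y \in S)) => yS.
  - apply/orP; right; rewrite inE /s; move: xS yS xy; rewrite !eS.
    rewrite !inE.
    by do 2![case/or4P=> /eqP->]; rewrite ?eqxx ?orbT // => _;
      rewrite colC ?eqxx ?orbT.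
  - by rewrite out // -eS.
  - by rewrite colC out // -eS.
  - apply/orP; left; apply/colorsP; exists x, y; split=> //; move: xS yS;
    by rewrite !eS !inE !negb_or ?xA ?yA !andbT => /and4P[? ? ? _] /and4P[? ? ? _];
      apply/andP; split => //; apply/andP.
apply: leq_trans (subset_leq_card sub) _.
apply: leq_trans (leq_card_setU _ _) _; rewrite leq_add2l.
by apply: leq_trans (_ : #|s| <= 6); [rewrite cardsE | exact: (card_size s)].
Qed.

(** The confined vertex [x] is itself the center of a private star with leaves [v], [z], [y], so one
    of [v] and [z] is confined. *)
Lemma third_confined S v x y z : S =i [:: v; x; y; z] ->
  uniq [:: v; x; y; z] -> {subset S <= A} -> confined A S x -> confined A S y ->
  exists a b c d, [/\ S =i [:: a; b; c; d], uniq [:: a; b; c; d],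
    confined A S a, confined A S b & confined A S c].
Proof.
move=> eS u4 sA cx cy.
have p1 : perm_eq [:: x; v; z; y] [:: v; x; y; z].
  by rewrite (perm_catCA [:: x] [:: v]) !perm_cons (perm_catC [:: z]).
have p2 : perm_eq [:: x; y; z; v] [:: v; x; y; z].
  by rewrite (perm_catC [:: x; y; z]).
have p3 : perm_eq [:: x; y; v; z] [:: v; x; y; z].
  by rewrite (perm_catCA [:: x; y] [:: v]).
have eS1 : S =i [:: x; v; z; y] by move=> i; rewrite eS (perm_mem p1).
have xA : x \in A by apply: sA; rewrite eS !inE eqxx orbT.
have [xv xz xy uc] := confined_star eS1 xA cx.
have u1 : uniq [:: x; v; z; y] by rewrite (perm_uniq p1).
have := private_star_confined u1 xv xz xy uc.
rewrite -!(eq_confined _ eS1) => /orP[cv|cz].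
  by exists x, y, v, z; split=> //; [move=> i; rewrite eS (perm_mem p3) | rewrite (perm_uniq p3)].
by exists x, y, z, v; split=> //; [move=> i; rewrite eS (perm_mem p2) | rewrite (perm_uniq p2)].
Qed.

Lemma three_confined_exists v : v \in A ->
  exists S a b c d, [/\ S =i [:: a; b; c; d], uniq [:: a; b; c; d],
    {subset S <= A} & [/\ confined A S a, confined A S b & confined A S c]].
Proof.
move=> vA.
have [x [y [z [u4 vx vy vz uc]]]] := private_star_exists vA (private3 vA).
pose S := [:: v; x; y; z].
have sA : {subset S <= A}.
  move=> i; rewrite !inE => /or4P[] /eqP-> //.
  - by case/and4P: vx.
  - by case/and4P: vy.
  - by case/and4P: vz.
suff [a [b [c [d [eS us ca cb cc]]]]] : exists a b c d,
    [/\ S =i [:: a; b; c; d], uniq [:: a; b; c; d],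
    confined A S a, confined A S b & confined A S c].
  by exists S, a, b, c, d.
have p1 : perm_eq [:: v; x; z; y] S by rewrite !perm_cons (perm_catC [:: z]).
have p2 : perm_eq [:: v; y; z; x] S by rewrite perm_cons (perm_catC [:: y; z]).
case/or3P: (private_star_two_confined u4 vx vy vz uc) => /andP[c1 c2].
- exact: (@third_confined S v x y z).
- by apply: (@third_confined S v x z y); rewrite ?(perm_uniq p1) // => i; rewrite (perm_mem p1).
- by apply: (@third_confined S v y z x); rewrite ?(perm_uniq p2) // => i; rewrite (perm_mem p2).
Qed.
End VertexSet.

(** * Induction on the size of the vertex set *)

Lemma colors_bound (A : {set T}) : 0 < #|A| -> #|colors A| < 2 * #|A|.
Proof.
have [m] := ubnP #|A|; elim: m A => // m IH A.
rewrite ltnS => Am A0; rewrite ltnNge; apply/negP => big.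
have [v0 v0A] : exists v, v \in A by apply/card_gt0P.
have cD1 v : v \in A -> #|A| = #|A :\ v|.+1 by move=> vA; rewrite (cardsD1 v) vA.
(* If deleting [v] cost at most two colors, the smaller set would violate the bound too. A singleton
   is treated apart, since the induction covers nonempty sets only. *)
have private3 v : v \in A -> 2 < #|colors A :\: colors (A :\ v)|.
  move=> vA; rewrite ltnNge; apply/negP => le2.
  have lec : #|colors A| <= #|colors (A :\ v)| + 2.
    rewrite -(cardsID (colors (A :\ v)) (colors A)) leq_add //.
    by rewrite subset_leq_card // subsetIr.
  case: (posnP #|A :\ v|) => [c0|c1].
    have e0 : colors A = set0.
      apply/setP => k; rewrite inE; apply/negbTE/negP.
      case/colorsP=> x [y [xA yA /negP xy _]]; apply: xy.
      have Av z : z \in A -> z = v.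
        move=> zA; apply/eqP/negbNE/negP => zv.
        by have := in_set0 z; rewrite -(cards0_eq c0) !inE zv zA.
      by rewrite (Av x xA) (Av y yA).
    by move: big; rewrite e0 cards0; lia.
  have := IH _ _ c1; rewrite (cD1 v vA) in Am big *; lia.
have [S [a [b [c [d [eS u4 sA [ca cb cc]]]]]]] := three_confined_exists private3 v0A.
have le6 := three_confined_colors private3 eS u4 sA ca cb cc.
have c3 : #|[set a; b; c]| = 3.
  move: u4; rewrite -setUA !cardsU1 cards1 /= !inE !negb_or.
  by case/and3P=> /and3P[-> -> _] /andP[-> _].
have s3 : [set a; b; c] \subset A.
  apply/subsetP => x; rewrite !inE => /orP[/orP[]|] /eqP->;
  by apply: sA; rewrite eS !inE eqxx ?orbT.
have cA : #|A| = (#|A :\: [set a; b; c]| + 3)%N.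
  by rewrite -(cardsID [set a; b; c] A) (setIidPr s3) c3 addnC.
have A'0 : 0 < #|A :\: [set a; b; c]|.
  apply/card_gt0P; exists d; rewrite !inE sA ?eS ?inE ?eqxx ?orbT // andbT.
  move: u4; rewrite /= !inE !negb_or.
  by case/and3P=> /and3P[_ _ ad] /andP[_ bd] /andP[cd _]; rewrite ![d == _]eq_sym ad bd cd.
(* Three deleted vertices pay for six colors: at most 2(|A| - 3) - 1 + 6 = 2|A| - 1 in total. *)
have := IH _ _ A'0; lia.
Qed.
End UpperBound.

(** * Transfer of the upper bound to [pr] *)

Lemma pc_K23_has_copy (n : nat) (K : finType) (c : {set 'I_n} -> K) u v x y z :
  pc_K23 (fun i j => c [set i; j]) u v x y z ->
  has_pc_copy c (complete_bipartite 2 3).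
Proof.
case/and5P=> us uu uv ux /andP[uy uz].
pose f (s : 'I_2 + 'I_3) : 'I_n :=
  match s with inl i => nth u [:: u; v] i | inr j => nth u [:: x; y; z] j end.
have ux' := ux; have uy' := uy; have uz' := uz.
rewrite eq_sym in ux'; rewrite eq_sym in uy'; rewrite eq_sym in uz'.
move: us uu uv; rewrite /= !inE !negb_or !andbT.
case/and4P=> /and4P[u_v u_x u_y u_z] /and3P[v_x v_y v_z] /andP[xy xz] yz.
case/andP=> /andP[uxy uxz] uyz /andP[/andP[vxy vxz] vyz].
apply/existsP; exists (finfun f); apply/andP; split.
  apply/injectiveP => s t; rewrite !ffunE.
  case: s => [[[|[|?]] ?]|[[|[|[|?]]] ?]] //;
  case: t => [[[|[|?]] ?]|[[|[|[|?]]] ?]] //= /eqP;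
  try (by move=> _; congr inl; apply: val_inj);
  try (by move=> _; congr inr; apply: val_inj);
  by move=> e; exfalso; move: e; apply/negP; neq.
apply/forallP => r; apply/forallP => s; apply/forallP => t; apply/implyP.
rewrite !ffunE.
case: r => [[[|[|?]] ?]|[[|[|[|?]]] ?]] //;
case: s => [[[|[|?]] ?]|[[|[|[|?]]] ?]] //;
case: t => [[[|[|?]] ?]|[[|[|[|?]]] ?]] //=;
try (by case/eqP; apply: val_inj); move=> _;
rewrite ?(setUC [set x] [set u]) ?(setUC [set x] [set v])
  ?(setUC [set y] [set u]) ?(setUC [set y] [set v])
  ?(setUC [set z] [set u]) ?(setUC [set z] [set v]); neq.
Qed.

Lemma pr_K23_upper n : 0 < n -> pr n (complete_bipartite 2 3) < 2 * n.
Proof.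
move=> n0; rewrite /pr.
have n20 : 0 < 2 * n by rewrite muln_gt0.
rewrite -(prednK n20) ltnS; apply/bigmax_leqP => c nc.
set col := fun i j => c [set i; j].
have colC i j : col i j = col j i by rewrite /col setUC.
have noK u v x y z : ~~ pc_K23 col u v x y z.
  by apply: contra nc; apply: pc_K23_has_copy.
have := colors_bound colC noK (A := [set: 'I_n]).
rewrite cardsT card_ord => /(_ n0) b.
rewrite -ltnS (prednK n20); apply: leq_ltn_trans b.
rewrite /num_colors cardE; apply: uniq_leq_size; first exact: undup_uniq.
move=> k; rewrite mem_undup mem_enum => /imageP[e eE ->].
move: eE; rewrite inE => /cards2P[x [y [xy ->]]]; apply/colorsP; exists x, y.
by rewrite !inE.
Qed.

(** * Lower bound: the block coloring *)

Definition block_coloring (n : nat) (e : {set 'I_n}) : {set 'I_n} + nat :=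
  if [forall x in e, forall y in e, x %/ 4 == y %/ 4] then inl e
  else inr (\max_(x in e) x %/ 4).

Lemma block_coloringE n (x y : 'I_n) : x != y ->
  block_coloring [set x; y] = if x %/ 4 == y %/ 4 then inl [set x; y]
                              else inr (maxn (x %/ 4) (y %/ 4)).
Proof.
move=> xy; rewrite /block_coloring.
have -> : [forall x0 in [set x; y], forall y0 in [set x; y], x0 %/ 4 == y0 %/ 4]
    = (x %/ 4 == y %/ 4).
  apply/forall_inP/eqP => [h|e s].
    by have /forall_inP/(_ y (set22 _ _))/eqP := h x (set21 _ _).
  rewrite !inE => /orP[]/eqP->; apply/forall_inP => t;
  by rewrite !inE => /orP[]/eqP->; rewrite ?e.
by case: ifP => // _; rewrite big_setU1 ?inE //= big_set1.
Qed.

(* For blocks r, s, t: the edges from r to s and from r to t share a color. *)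
Definition clash (r s t : nat) : bool :=
  [&& r != s, r != t & maxn r s == maxn r t].

(** Every edge from block [r] to a lower block has color [r]. *)
Lemma clash_top r s t : ~~ clash r s t -> s <= r -> t <= r -> r = s \/ r = t.
Proof.
move=> + /maxn_idPl sr /maxn_idPl tr.
by rewrite /clash sr tr eqxx andbT; case: eqP => [|_]; case: eqP; auto.
Qed.

Lemma clash_same r s : ~~ clash r s s -> r = s.
Proof. by rewrite /clash eqxx andbT andbb negbK => /eqP. Qed.

(** By [clash_top] at [u], two of [x], [y], [z] equal [u]. Then [v] has two neighbors in block [u],
    so [v] = [u]; now each of [x], [y], [z] has both neighbors in block [u] and lies there too. *)
Lemma no_clash_top u v x y z :
  ~~ clash u x y -> ~~ clash u x z -> ~~ clash u y z ->
  ~~ clash v x y -> ~~ clash v x z -> ~~ clash v y z ->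
  ~~ clash x u v -> ~~ clash y u v -> ~~ clash z u v ->
  x <= u -> y <= u -> z <= u -> [/\ u = v, u = x, u = y & u = z].
Proof.
move=> uxy uxz uyz vxy vxz vyz xuv yuv zuv xu yu zu.
have ev : u = v.
  case: (clash_top uxy xu yu) => e; rewrite -e in vxy vxz vyz uyz uxz.
    case: (clash_top uyz yu zu) => e'; rewrite -e' in vxy vxz.
      by rewrite (clash_same vxy).
    by rewrite (clash_same vxz).
  case: (clash_top uxz xu zu) => e'; rewrite -e' in vxy vyz.
    by rewrite (clash_same vxy).
  by rewrite (clash_same vyz).
rewrite -ev in xuv yuv zuv.
by rewrite (clash_same xuv) (clash_same yuv) (clash_same zuv).
Qed.

(** With [v] <= [u], a block among [x], [y], [z] above [u] would send its color to both [u] and [v].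
    Hence [u] is a top block. *)
Lemma no_clash_eq u v x y z :
  ~~ clash u x y -> ~~ clash u x z -> ~~ clash u y z ->
  ~~ clash v x y -> ~~ clash v x z -> ~~ clash v y z ->
  ~~ clash x u v -> ~~ clash y u v -> ~~ clash z u v ->
  [/\ u = v, u = x, u = y & u = z].
Proof.
wlog vu : u v / v <= u => [H|] uxy uxz uyz vxy vxz vyz xuv yuv zuv.
  have clashC r : clash r u v = clash r v u by rewrite /clash andbCA [maxn r u == _]eq_sym.
  case: (leqP v u) => [vu|/ltnW uv]; first exact: H.
  by rewrite clashC in xuv; rewrite clashC in yuv; rewrite clashC in zuv;
    case: (H v u uv vxy vxz vyz uxy uxz uyz xuv yuv zuv) => -> <- <- <-.
suff le w : ~~ clash w u v -> w <= u by apply: (no_clash_top (v := v)) => //; exact: le.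
move=> h; rewrite leqNgt; apply/negP => uw.
by case: (clash_top h (ltnW uw) (leq_trans vu (ltnW uw))) => e; lia.
Qed.

Lemma block_coloring_noK23 n :
  ~~ has_pc_copy (@block_coloring n) (complete_bipartite 2 3).
Proof.
apply/negP => /existsP[f /andP[/injectiveP fi /forallP h]].
have hh r s t : adj (s := complete_bipartite 2 3) r s -> adj r t -> s != t ->
    ~~ clash (f r %/ 4) (f s %/ 4) (f t %/ 4).
  move=> rs rt st; apply/negP => /and3P[/negPf rs4 /negPf rt4 /eqP e].
  have /forallP/(_ t) := forallP (h r) s; rewrite rs rt st /=.
  have frs w : adj r w -> f r != f w.
    by move=> rw; apply/eqP => /fi rw'; move: rw; rewrite rw' adj_irrefl.
  by rewrite !block_coloringE ?frs // rs4 rt4 e eqxx.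
pose a0 : complete_bipartite 2 3 := inl (@Ordinal 2 0 isT).
pose a1 : complete_bipartite 2 3 := inl (@Ordinal 2 1 isT).
pose b0 : complete_bipartite 2 3 := inr (@Ordinal 3 0 isT).
pose b1 : complete_bipartite 2 3 := inr (@Ordinal 3 1 isT).
pose b2 : complete_bipartite 2 3 := inr (@Ordinal 3 2 isT).
have [e1 e2 e3 e4] : [/\ f a0 %/ 4 = f a1 %/ 4, f a0 %/ 4 = f b0 %/ 4,
    f a0 %/ 4 = f b1 %/ 4 & f a0 %/ 4 = f b2 %/ 4].
  by apply: no_clash_eq; apply: hh.
pose s := [:: f a0; f a1; f b0; f b1; f b2].
have us : uniq s by rewrite -[s]/(map f [:: a0; a1; b0; b1; b2]) map_inj_uniq.
(* Pigeonhole: five distinct vertices would lie in a block of four. *)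
have sub : {subset map val s <= iota (f a0 %/ 4 * 4) 4}.
  move=> k; rewrite mem_iota /= !inE => hk.
  have <- : k %/ 4 = f a0 %/ 4.
    by move: hk => /or4P[||| /orP[]] /eqP->.
  lia.
by have := uniq_leq_size _ sub; rewrite (map_inj_uniq val_inj) us => /(_ isT).
Qed.

(** * Counting the colors of the block coloring *)

(* The six edges of a block and one edge to the next block. *)
Definition block_pairs : seq (nat * nat) :=
  [:: (0, 1); (0, 2); (0, 3); (1, 2); (1, 3); (2, 3); (0, 4)].

Lemma block_pairsP p : p \in block_pairs -> p.1 < p.2 /\ p.2 <= 4.
Proof.
move=> pb; apply/andP; move: p pb.
by apply/(allP (a := fun p : nat * nat => (p.1 < p.2) && (p.2 <= 4))).
Qed.

Lemma block_edge_val n p q : p \in block_pairs -> q.+1 < n.+1 %/ 4 ->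
  (inord (q * 4 + p.1) : 'I_n.+1) = q * 4 + p.1 :> nat /\
  (inord (q * 4 + p.2) : 'I_n.+1) = q * 4 + p.2 :> nat.
Proof. by move=> /block_pairsP[p1 p2] qn; rewrite !inordK //; lia. Qed.

Definition block_edge n (p : nat * nat) (q : nat) : {set 'I_n.+1} :=
  [set inord (q * 4 + p.1); inord (q * 4 + p.2)].

Lemma block_edge_color n p q : p \in block_pairs -> q.+1 < n.+1 %/ 4 ->
  block_coloring (block_edge n p q) =
    if p.2 == 4 then inr q.+1 else inl (block_edge n p q).
Proof.
move=> pb qn; rewrite /block_edge.
have [p1 p2] : p.1 < p.2 /\ p.2 <= 4.
  by apply: block_pairsP.
have [v1 v2] := block_edge_val pb qn.
rewrite block_coloringE; last by rewrite -val_eqE /= v1 v2; lia.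
rewrite v1 v2.
have -> : (q * 4 + p.1) %/ 4 = q by lia.
case: (eqVneq p.2 4) => [->|p24].
  by rewrite divnMDl // divnn addn1; case: eqP => [|_]; [lia | congr inr; lia].
have -> : (q * 4 + p.2) %/ 4 = q by lia.
by rewrite eqxx.
Qed.

Lemma block_edge_inj n p q p' q' : p \in block_pairs -> p' \in block_pairs ->
  q.+1 < n.+1 %/ 4 -> q'.+1 < n.+1 %/ 4 ->
  block_edge n p q = block_edge n p' q' -> p = p' /\ q = q'.
Proof.
move=> pb pb' qn qn' e.
have [v1 v2] := block_edge_val pb qn; have [v1' v2'] := block_edge_val pb' qn'.
have := set21 (inord (q * 4 + p.1) : 'I_n.+1) (inord (q * 4 + p.2)).
have := set22 (inord (q * 4 + p.1) : 'I_n.+1) (inord (q * 4 + p.2)).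
rewrite -/(block_edge n p q) e !inE -!val_eqE /= v1 v2 v1' v2'.
have [p1 p2] := block_pairsP pb; have [p1' p2'] := block_pairsP pb'.
case: p p' p1 p2 p1' p2' {pb pb' e v1 v2 v1' v2'} => [a b] [a' b'] /= *.
have [-> [-> ->]] : a = a' /\ b = b' /\ q = q' by lia.
by [].
Qed.

Lemma block_coloring_colors n :
  7 * (n.+1 %/ 4).-1 <= num_colors (@block_coloring n.+1).
Proof.
(* The last full block is left out, so that the edge to the next block always exists. *)
set m := (n.+1 %/ 4).-1.
have mP q : q \in iota 0 m -> q.+1 < n.+1 %/ 4 by rewrite mem_iota /m; lia.
pose L := [seq block_coloring (block_edge n p q) | p <- block_pairs, q <- iota 0 m].
have -> : 7 * m = size L by rewrite size_allpairs size_iota.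
apply: uniq_leq_size.
  apply: allpairs_uniq => //; first exact: iota_uniq.
  move=> r r' /allpairsP[[p1 q1] [pb qm ->]] /allpairsP[[p2 q2] [pb' qm' ->]].
  rewrite /fst /snd in pb qm pb' qm'; rewrite /= !block_edge_color ?mP //.
  case: eqP => e; case: eqP => e' //.
    (* A cross color determines its block, and each block lists only one cross edge. *)
    case=> ->; suff P04 t : t \in block_pairs -> t.2 = 4 -> t = (0, 4).
      by rewrite (P04 p1) // (P04 p2).
    by rewrite !inE; do ![case/predU1P=> [->//|]] => /eqP->.
  by case=> /(block_edge_inj pb pb' (mP _ qm) (mP _ qm')) [-> ->].
move=> k /allpairsP[[p q] /= [pb qm ->]]; rewrite mem_undup.
apply: image_f; rewrite inE cards2.
have [p1 p2] := block_pairsP pb; have [v1 v2] := block_edge_val pb (mP _ qm).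
by rewrite -val_eqE /= v1 v2; case: eqP => //; lia.
Qed.

(** * Both bounds over the rationals *)

Import GRing.Theory Num.Theory.
Local Open Scope ring_scope.

Theorem theorem6 :
  exists C : rat, forall n : nat, (5 <= n)%N ->
    7%:R / 4%:R * n%:R - C <= (pr n (complete_bipartite 2 3))%:R :> rat /\
    (pr n (complete_bipartite 2 3))%:R <= 2%:R * n%:R - 1 :> rat.
Proof.
(* With N vertices, 4 floor(N/4) >= N - 3 gives 7(floor(N/4) - 1) >= (7N - 49)/4, and 13 is 49/4
   rounded up. *)
exists 13%:R; case=> // n n5; split.
  have := leq_trans (block_coloring_colors n) (pr_max (block_coloring_noK23 _)).
  set m := pr _ _ => h.
  have {}h : (7 * n.+1 <= 4 * m + 52)%N by lia.
  by move: h; rewrite -(ler_nat rat) natrD !natrM; lra.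
have := pr_K23_upper (ltn0Sn n); set m := pr _ _ => h.
have {}h : (m + 1 <= 2 * n.+1)%N by rewrite addn1.
by move: h; rewrite -(ler_nat rat) natrD !natrM; lra.
Qed.
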